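(* Let $X$ be a path connected, locally path connected topological space with base point $x_0$ which is SLT at $x_0$, and let $H\unlhd\pi_1(X,x_0)$ be a normal subgroup. Then the endpoint projection $p_H:\tilde X_H^{wh}\to X$ has the unique path lifting property if and only if $H$ is a closed subgroup of $\pi_1^{qtop}(X,x_0)$.
   Context: Let $\ast$ denote concatenation of paths and $\alpha^{-1}$ the reverse path. $P(X,x_0)$ is the set of paths in $X$ starting at $x_0$. For $H\le\pi_1(X,x_0)$ put $\alpha\sim_H\beta$ iff $\alpha(1)=\beta(1)$ and $[\alpha\ast\beta^{-1}]\in H$; $[\alpha]_H$ is the class of $\alpha$ and $\tilde X_H$ the set of classes. The whisker topology on $\tilde X_H$ has basis the sets $([\alpha]_H,U)=\{[\alpha\ast\beta]_H:\beta\text{ a path in }U\text{ with }\beta(0)=\alpha(1)\}$, where $\alpha\in P(X,x_0)$ and $U$ is an open neighborhood of $\alpha(1)$; the resulting space is $\tilde X_H^{wh}$. The endpoint projection is $p_H([\alpha]_H)=\alpha(1)$. It has the unique path lifting property if any two paths in $\tilde X_H^{wh}$ with the same initial point and the same image path under $p_H$ are equal. $\pi_1^{qtop}(X,x_0)$ is the fundamental group with the quotient topology from the space of loops based at $x_0$ with the compact-open topology. $X$ is SLT at $x_0$ (small loop transfer) if for every path $\alpha$ in $X$ with $\alpha(0)=x_0$ and every neighborhood $U$ of $x_0$ there is a neighborhood $V$ of $\alpha(1)$ such that for every loop $\beta$ in $V$ based at $\alpha(1)$ there is a loop $\gamma$ in $U$ based at $x_0$ which is homotopic to $\alpha\ast\beta\ast\alpha^{-1}$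 relative to endpoints. *)

(* Defs.v *)
From HB Require Import structures.
From mathcomp Require Import all_boot all_order all_algebra.
From mathcomp Require Import generic_quotient.
From mathcomp Require Import all_classical all_reals topology normedtype homotopy.
From mathcomp Require Import lra.

Set Implicit Arguments.
Unset Strict Implicit.
Unset Printing Implicit Defensive.

Import Order.TTheory GRing.Theory Num.Theory.
Import numFieldNormedType.Exports.

Local Open Scope classical_set_scope.
Local Open Scope ring_scope.
Local Open Scope quotient_scope.

Definition unit_interval (R : realType) : Type :=
  set_type (`[0, 1]%classic : set R).

Section unit_interval.
Variable R : realType.
Local Notation I := (unit_interval R).

HB.instance Definition _ :=
  Topological.copy I (set_type (`[0, 1]%classic : set R)).

Definition ival (t : I) : R := set_val t.

Lemma clamp_subproof (x : R) :
  Num.max 0 (Num.min 1 x) \in (`[0, 1]%classic : set R).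
Proof.
apply/mem_set; rewrite /= in_itv /=; apply/andP; split.
  by rewrite le_max lexx.
by rewrite ge_max ler01 ge_min lexx.
Qed.

(* The nearest-point retraction of the line onto [0, 1]; it only serves to
   write elements of [0, 1] as real expressions. *)
Definition clamp (x : R) : I := exist (fun y => y \in (`[0, 1]%classic : set R)) _ (clamp_subproof x).

Lemma ival_ge0 t : 0 <= ival t.
Proof. by case: t => x xI; have /set_mem/= := xI; rewrite in_itv => /andP[]. Qed.

Lemma ival_le1 t : ival t <= 1.
Proof. by case: t => x xI; have /set_mem/= := xI; rewrite in_itv => /andP[]. Qed.

Lemma clampE x : 0 <= x -> x <= 1 -> ival (clamp x) = x.
Proof. by move=> x0 x1; rewrite /ival/= set_valE/= min_r// max_r. Qed.

Lemma ival_inj : injective ival.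
Proof. by move=> s t; rewrite /ival set_valE => /val_inj. Qed.

Lemma ivalK : cancel ival clamp.
Proof. by move=> t; apply: ival_inj; rewrite clampE ?ival_ge0 ?ival_le1. Qed.

Lemma interval_zero_one_neq : clamp 0 != clamp 1.
Proof.
by apply/eqP => /(congr1 ival); rewrite !clampE// => /esym/eqP; rewrite oner_eq0.
Qed.

HB.instance Definition _ := isBiPointed.Build I interval_zero_one_neq.

Lemma ival0 : ival zero = 0. Proof. by rewrite clampE. Qed.
Lemma ival1 : ival one = 1. Proof. by rewrite clampE. Qed.

Lemma clamp_le0 x : x <= 0 -> clamp x = zero.
Proof.
move=> x0; apply: ival_inj; rewrite ival0 /ival/= set_valE/= max_l//.
by rewrite ge_min x0 orbT.
Qed.

Lemma clamp_ge1 x : 1 <= x -> clamp x = one.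
Proof.
by move=> x1; apply: ival_inj; rewrite ival1 /ival/= set_valE/= min_l// max_r.
Qed.

Lemma ival_continuous : continuous ival.
Proof. exact: initial_continuous. Qed.

Lemma clamp_comp_continuous (T : topologicalType) (u : T -> R) :
  continuous u -> continuous (clamp \o u).
Proof.
move=> cu; apply: continuous_comp_initial => t.
apply: (@continuous_max _ _ (fun=> 0) (fun s => Num.min 1 (u s))).
  exact: cst_continuous.
apply: (@continuous_min _ _ (fun=> 1) u); first exact: cst_continuous.
exact: cu.
Qed.

End unit_interval.
Arguments clamp {R}.

Lemma paste_continuous (R : realType) (T X : topologicalType) (u : T -> R)
    (c : R) (f g : T -> X) :
  continuous u -> continuous f -> continuous g ->
  (forall t, u t = c -> f t = g t) ->
  continuous (fun t => if u t <= c then f t else g t).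
Proof.
move=> cu cf cg fg; apply/continuous_closedP => C cC.
rewrite (_ : _ @^-1` C = (u @^-1` [set x | x <= c] `&` f @^-1` C) `|`
                         (u @^-1` [set x | c <= x] `&` g @^-1` C)).
  apply: closedU; apply: closedI.
  - by move/continuous_closedP : cu; apply; exact: closed_le.
  - by move/continuous_closedP : cf; exact.
  - by move/continuous_closedP : cu; apply; exact: closed_ge.
  - by move/continuous_closedP : cg; exact.
apply/seteqP; split => t /=.
  by case: ifPn => [uc Cf|]; [left|rewrite -ltNge => /ltW ? ?; right].
case=> -[uc Ct]; first by rewrite uc.
case: ifPn => // uc'; rewrite fg//; apply/eqP; rewrite eq_le uc' //.
Qed.

Section concatenation.
Variables (R : realType) (X : topologicalType).
Local Notation I := (unit_interval R).
Implicit Types f g h k : I -> X.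

Definition concat f g : I -> X := fun t =>
  if ival t <= 2^-1 then f (clamp (2 * ival t)) else g (clamp (2 * ival t - 1)).

Definition reverse f : I -> X := fun t => f (clamp (1 - ival t)).

Let ctD (T : topologicalType) (u v : T -> R) :
  continuous u -> continuous v -> continuous (fun t => u t + v t).
Proof. by move=> cu cv t; apply: cvgD; [exact: cu|exact: cv]. Qed.

Let ctM (T : topologicalType) (u v : T -> R) :
  continuous u -> continuous v -> continuous (fun t => u t * v t).
Proof. by move=> cu cv t; apply: cvgM; [exact: cu|exact: cv]. Qed.

Let ctmin (T : topologicalType) (u v : T -> R) :
  continuous u -> continuous v -> continuous (fun t => Num.min (u t) (v t)).
Proof.
by move=> cu cv t; apply: (@continuous_min _ _ u v); [exact: cu|exact: cv].
Qed.

Let ctC (T : topologicalType) (a : R) : continuous (fun _ : T => a).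
Proof. exact: cst_continuous. Qed.

Let scale_continuous (a b : R) : continuous (fun t : I => a * ival t + b).
Proof.
by apply: ctD => //; apply: ctM => //; exact: ival_continuous.
Qed.

Lemma affine_continuous (a b : R) :
  continuous (fun t : I => clamp (a * ival t + b)).
Proof. exact (clamp_comp_continuous (@scale_continuous a b)). Qed.

Let half2 : 2 / 2 = 1 :> R. Proof. by rewrite divff// pnatr_eq0. Qed.

Lemma concat_left_continuous : continuous (fun t : I => clamp (2 * ival t)).
Proof.
under eq_fun do rewrite -[2 * _]addr0.
exact: affine_continuous.
Qed.

Lemma concat_right_continuous : continuous (fun t : I => clamp (2 * ival t - 1)).
Proof. exact: affine_continuous. Qed.

Lemma flip_continuous : continuous (fun t : I => clamp (1 - ival t)).
Proof.
under eq_fun do rewrite addrC -mulN1r.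
exact: affine_continuous.
Qed.

Lemma continuous_compT (S T U : topologicalType) (a : S -> T) (b : T -> U) :
  continuous a -> continuous b -> continuous (b \o a).
Proof.
by move=> ca cb t; apply: continuous_comp; [exact: ca|exact: cb].
Qed.

Lemma concat_continuous f g : continuous f -> continuous g -> f one = g zero ->
  continuous (concat f g).
Proof.
move=> cf cg fg.
apply: (@paste_continuous R I X (@ival R) 2^-1 (f \o (fun t => clamp (2 * ival t)))
  (g \o (fun t => clamp (2 * ival t - 1)))).
- exact: ival_continuous.
- exact (continuous_compT concat_left_continuous cf).
- exact (continuous_compT concat_right_continuous cg).
- by move=> t /= ->; rewrite half2 subrr fg.
Qed.

Lemma reverse_continuous f : continuous f -> continuous (reverse f).
Proof. by move=> cf; exact (continuous_compT flip_continuous cf). Qed.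

Lemma concat0 f g : concat f g zero = f zero.
Proof. by rewrite /concat ival0 invr_ge0 ler0n mulr0. Qed.

Lemma concat1 f g : concat f g one = g one.
Proof.
rewrite /concat ival1 ifF ?mulr1; last by apply/negbTE; rewrite -ltNge; lra.
by rewrite (_ : 2 - 1 = 1)//; lra.
Qed.

Lemma reverse0 f : reverse f zero = f one.
Proof. by rewrite /reverse ival0 subr0. Qed.

Lemma reverse1 f : reverse f one = f zero.
Proof. by rewrite /reverse ival1 subrr. Qed.

Lemma reverseK f : reverse (reverse f) = f.
Proof.
apply/funext => t; rewrite /reverse clampE ?subKr ?ivalK//.
- by rewrite subr_ge0 ival_le1.
- by rewrite gerBl ival_ge0.
Qed.

Lemma reverse_concat f g : f one = g zero ->
  reverse (concat f g) = concat (reverse g) (reverse f).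
Proof.
move=> fg; apply/funext => t; rewrite /reverse /concat.
have t0 := ival_ge0 t; have t1 := ival_le1 t.
rewrite (clampE (x := 1 - ival t)); [|lra|lra].
case: (ltgtP (ival t) 2^-1) => th.
- rewrite ifF; last by apply/negbTE; rewrite -ltNge; lra.
  by rewrite clampE; [congr (g (clamp _)); lra|lra|lra].
- rewrite ifT; last by lra.
  by rewrite clampE; [congr (f (clamp _)); lra|lra|lra].
- rewrite ifT; last by lra.
  rewrite th half2 (_ : 2 * (1 - 2^-1) = 1); last by lra.
  by rewrite fg clampE// subrr.
Qed.

(* Homotopy relative to the endpoints; it forces f and g to be continuous with
   common endpoints. *)
Definition path_homotopic f g : Prop :=
  exists F : I * I -> X,
    [/\ continuous F,
        forall t, F (t, zero) = f t, forall t, F (t, one) = g t,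
        forall s, F (zero, s) = f zero & forall s, F (one, s) = f one].

Local Notation "f ~ g" := (path_homotopic f g) (at level 70).

Let fst_ct (S T : topologicalType) : continuous (fst : S * T -> S).
Proof. by move=> x; exact: cvg_fst. Qed.

Let snd_ct (S T : topologicalType) : continuous (snd : S * T -> T).
Proof. by move=> x; exact: cvg_snd. Qed.

Let pair_ct (S T U : topologicalType) (a : S -> T) (b : S -> U) :
  continuous a -> continuous b -> continuous (fun s => (a s, b s)).
Proof. by move=> ca cb s; apply: cvg_pair; [exact: ca|exact: cb]. Qed.

Lemma path_homotopic_refl f : continuous f -> f ~ f.
Proof.
move=> cf; exists (f \o fst); split=> //.
exact (continuous_compT (@fst_ct _ _) cf).
Qed.

Lemma path_homotopic_ends f g : f ~ g -> f zero = g zero /\ f one = g one.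
Proof. by case=> F [_ F0 F1 Fz Fo]; rewrite -!F1 Fz Fo. Qed.

Lemma path_homotopic_sym f g : f ~ g -> g ~ f.
Proof.
move=> fg; have [fg0 fg1] := path_homotopic_ends fg.
case: fg => F [cF F0 F1 Fz Fo].
exists (F \o (fun p => (p.1, clamp (1 - ival p.2)))); split => /=.
- apply: continuous_compT => //; apply: pair_ct; first exact: fst_ct.
  exact (continuous_compT (@snd_ct _ _) flip_continuous).
- by move=> t; rewrite ival0 subr0 F1.
- by move=> t; rewrite ival1 subrr F0.
- by move=> s; rewrite Fz fg0.
- by move=> s; rewrite Fo fg1.
Qed.

Lemma path_homotopic_trans g f h : f ~ g -> g ~ h -> f ~ h.
Proof.
move=> fg; have [fg0 fg1] := path_homotopic_ends fg.
case: fg => F [cF F0 F1 Fz Fo] [G [cG G0 G1 Gz Go]].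
pose K (p : I * I) := if ival p.2 <= 2^-1 then F (p.1, clamp (2 * ival p.2))
  else G (p.1, clamp (2 * ival p.2 - 1)).
exists K; split.
- apply: (@paste_continuous R (I * I)%type X (fun p => ival p.2) 2^-1
    (F \o (fun p => (p.1, clamp (2 * ival p.2))))
    (G \o (fun p => (p.1, clamp (2 * ival p.2 - 1))))).
  + exact (continuous_compT (@snd_ct _ _) (@ival_continuous _)).
  + apply: continuous_compT => //; apply: pair_ct; first exact: fst_ct.
    exact (continuous_compT (@snd_ct _ _) concat_left_continuous).
  + apply: continuous_compT => //; apply: pair_ct; first exact: fst_ct.
    exact (continuous_compT (@snd_ct _ _) concat_right_continuous).
  + by move=> p /= ->; rewrite half2 subrr F1 G0.
- by move=> t; rewrite /K/= ival0 invr_ge0 ler0n mulr0 F0.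
- move=> t; rewrite /K/= ival1 ifF; last by apply/negbTE; rewrite -ltNge; lra.
  by rewrite (_ : 2 * 1 - 1 = 1) ?G1//; lra.
- by move=> s; rewrite /K/=; case: ifPn => _; rewrite ?Fz ?Gz ?fg0.
- by move=> s; rewrite /K/=; case: ifPn => _; rewrite ?Fo ?Go ?fg1.
Qed.

Lemma path_homotopic_concat f f' g g' : f one = g zero ->
  f ~ f' -> g ~ g' -> concat f g ~ concat f' g'.
Proof.
move=> fg [F [cF F0 F1 Fz Fo]] [G [cG G0 G1 Gz Go]].
pose K (p : I * I) := if ival p.1 <= 2^-1 then F (clamp (2 * ival p.1), p.2)
  else G (clamp (2 * ival p.1 - 1), p.2).
exists K; split.
- apply: (@paste_continuous R (I * I)%type X (fun p => ival p.1) 2^-1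
    (F \o (fun p => (clamp (2 * ival p.1), p.2)))
    (G \o (fun p => (clamp (2 * ival p.1 - 1), p.2)))).
  + exact (continuous_compT (@fst_ct _ _) (@ival_continuous _)).
  + apply: continuous_compT => //; apply: pair_ct; last exact: snd_ct.
    exact (continuous_compT (@fst_ct _ _) concat_left_continuous).
  + apply: continuous_compT => //; apply: pair_ct; last exact: snd_ct.
    exact (continuous_compT (@fst_ct _ _) concat_right_continuous).
  + by move=> p /= ->; rewrite half2 subrr Fo Gz.
- by move=> t; rewrite /K/= /concat F0 G0.
- by move=> t; rewrite /K/= /concat F1 G1.
- by move=> s; rewrite concat0 /K/= ival0 invr_ge0 ler0n mulr0 Fz.
- move=> s; rewrite concat1 /K/= ival1 ifF; last by apply/negbTE; rewrite -ltNge; lra.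
  by rewrite (_ : 2 * 1 - 1 = 1) ?Go//; lra.
Qed.

Lemma path_homotopic_reverse f g : f ~ g -> reverse f ~ reverse g.
Proof.
move=> [F [cF F0 F1 Fz Fo]].
exists (F \o (fun p => (clamp (1 - ival p.1), p.2))); split => /=.
- apply: continuous_compT => //; apply: pair_ct; last exact: snd_ct.
  exact (continuous_compT (@fst_ct _ _) flip_continuous).
- by move=> t; rewrite F0.
- by move=> t; rewrite F1.
- by move=> s; rewrite ival0 subr0 Fo reverse0.
- by move=> s; rewrite ival1 subrr Fz reverse1.
Qed.

Lemma path_homotopic_reparam f (phi psi : I -> I) :
  continuous f -> continuous phi -> continuous psi ->
  phi zero = psi zero -> phi one = psi one -> f \o phi ~ f \o psi.
Proof.
move=> cf cphi cpsi e0 e1.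
pose u (p : I * I) : R :=
  (1 - ival p.2) * ival (phi p.1) + ival p.2 * ival (psi p.1).
have cu : continuous u.
  have c1 : continuous (fun p : I * I => ival (phi p.1)).
    apply: (continuous_compT (b := @ival R \o phi) (@fst_ct _ _)).
    exact (continuous_compT cphi (@ival_continuous R)).
  have c2 : continuous (fun p : I * I => ival (psi p.1)).
    apply: (continuous_compT (b := @ival R \o psi) (@fst_ct _ _)).
    exact (continuous_compT cpsi (@ival_continuous R)).
  have c3 : continuous (fun p : I * I => ival p.2).
    exact (continuous_compT (@snd_ct _ _) (@ival_continuous R)).
  apply: ctD; apply: ctM => //; apply: ctD => //.
  by move=> p; apply: cvgN; exact: c3.
exists (f \o (clamp \o u)); split => /=.
- exact (continuous_compT (clamp_comp_continuous cu) cf).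
- by move=> t; rewrite /u/= ival0 subr0 mul1r mul0r addr0 ivalK.
- by move=> t; rewrite /u/= ival1 subrr mul1r mul0r add0r ivalK.
- by move=> s; rewrite /u/= -e0 -mulrDl subrK mul1r ivalK.
- by move=> s; rewrite /u/= -e1 -mulrDl subrK mul1r ivalK.
Qed.

Lemma path_homotopic_concatA f g h :
  continuous f -> continuous g -> continuous h ->
  f one = g zero -> g one = h zero ->
  concat (concat f g) h ~ concat f (concat g h).
Proof.
move=> cf cg ch fg gh.
pose v (t : I) : R :=
  Num.min (2 * ival t) (Num.min (ival t + 4^-1) (2^-1 * ival t + 2^-1)).
have cv : continuous v.
  apply: ctmin; first by apply: ctM => //; exact: ival_continuous.
  apply: ctmin; last exact: scale_continuous.
  by apply: ctD => //; exact: ival_continuous.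
have vE t : v t = if ival t <= 4^-1 then 2 * ival t else
            if ival t <= 2^-1 then ival t + 4^-1 else 2^-1 * ival t + 2^-1.
  have t0 := ival_ge0 t; have t1 := ival_le1 t; rewrite /v /Order.min.
  by repeat case: ifPn; rewrite -?leNgt -?ltNge => *; lra.
have v01 t : 0 <= v t <= 1.
  have t0 := ival_ge0 t; have t1 := ival_le1 t; rewrite vE.
  by repeat case: ifPn; rewrite -?leNgt -?ltNge => *; lra.
rewrite (_ : concat (concat f g) h = concat f (concat g h) \o (clamp \o v)).
  rewrite -[X in _ ~ X](_ : concat f (concat g h) \o id = _)//.
  apply: path_homotopic_reparam => //.
  - apply: concat_continuous; rewrite ?concat0//; exact: concat_continuous.
  - exact: clamp_comp_continuous.
  - by move=> t; exact: cvg_id.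
  - by rewrite /comp vE ival0 ifT ?mulr0//; lra.
  - rewrite /comp vE ival1 !ifF; [|apply/negbTE; lra|apply/negbTE; lra].
    by rewrite (_ : 2^-1 * 1 + 2^-1 = 1)//; lra.
apply/funext => t /=; have t0 := ival_ge0 t; have t1 := ival_le1 t.
have /andP[v0 v1] := v01 t.
rewrite [RHS]/concat (clampE v0 v1) vE.
case: (leP (ival t) 4^-1) => t4.
  rewrite [LHS]/concat ifT; [|lra].
  rewrite [RHS]ifT; [|lra].
  rewrite /concat clampE; [|lra|lra].
  by rewrite ifT; [congr (f (clamp _)); lra|lra].
case: (leP (ival t) 2^-1) => t2.
  rewrite [LHS]/concat ifT; [|lra].
  rewrite [RHS]ifF; last by apply/negbTE; lra.
  rewrite /concat !clampE; [|lra|lra|lra|lra].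
  rewrite [LHS]ifF; last by apply/negbTE; lra.
  by rewrite ifT; [congr (g (clamp _)); lra|lra].
rewrite [LHS]/concat ifF; last by apply/negbTE; lra.
rewrite [RHS]ifF; last by apply/negbTE; lra.
rewrite /concat !clampE; [|lra|lra].
rewrite ifF; last by apply/negbTE; lra.
by congr (h (clamp _)); lra.
Qed.

Lemma path_homotopic_concat_cstl f : continuous f -> concat (cst (f zero)) f ~ f.
Proof.
move=> cf; rewrite -[X in _ ~ X](_ : f \o id = _)//.
rewrite (_ : concat _ f = f \o (fun t => clamp (2 * ival t - 1))); last first.
  apply/funext => t; rewrite /concat/=; case: ifPn => // th.
  by rewrite [in RHS]clamp_le0//; lra.
apply: path_homotopic_reparam => //.
- exact: concat_right_continuous.
- by move=> t; exact: cvg_id.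
- by rewrite clamp_le0// ival0; lra.
- by rewrite ival1 (_ : 2 * 1 - 1 = 1)//; lra.
Qed.

Lemma path_homotopic_concat_cstr f : continuous f -> concat f (cst (f one)) ~ f.
Proof.
move=> cf; rewrite -[X in _ ~ X](_ : f \o id = _)//.
rewrite (_ : concat f _ = f \o (fun t => clamp (2 * ival t))); last first.
  apply/funext => t; rewrite /concat/=; case: ifPn => // th.
  by rewrite [in RHS]clamp_ge1//; lra.
apply: path_homotopic_reparam => //.
- exact: concat_left_continuous.
- by move=> t; exact: cvg_id.
- by rewrite ival0 mulr0.
- by rewrite clamp_ge1// ival1; lra.
Qed.

Lemma path_homotopic_concatV f : continuous f ->
  concat f (reverse f) ~ cst (f zero).
Proof.
move=> cf.
pose v (t : I) : R := Num.min (2 * ival t) (2 - 2 * ival t).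
have cv : continuous v.
  apply: ctmin; first by apply: ctM => //; exact: ival_continuous.
  under eq_fun do rewrite addrC -mulNr.
  exact: scale_continuous.
have vE t : v t = if ival t <= 2^-1 then 2 * ival t else 2 - 2 * ival t.
  by rewrite /v /Order.min; repeat case: ifPn; rewrite -?leNgt -?ltNge => *; lra.
rewrite (_ : concat f _ = f \o (clamp \o v)).
  rewrite (_ : cst (f zero) = f \o cst zero)//.
  apply: path_homotopic_reparam => //.
  - exact: clamp_comp_continuous.
  - by move=> ?; exact: cst_continuous.
  - by rewrite /comp vE ival0 ifT ?mulr0//; lra.
  - rewrite /comp vE ival1 ifF; last by apply/negbTE; lra.
    by rewrite mulr1 subrr.
apply/funext => t; have t0 := ival_ge0 t; have t1 := ival_le1 t.
rewrite /concat /comp vE /reverse; case: ifPn => // th.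
by rewrite clampE; [congr (f (clamp _)); lra|lra|lra].
Qed.

Lemma path_homotopic_cancel f g h :
  continuous f -> continuous g -> continuous h ->
  f one = g zero -> h zero = g zero ->
  concat (concat f g) (concat (reverse g) h) ~ concat f h.
Proof.
move=> cf cg ch fg hg; have crg := reverse_continuous cg.
have rgh : reverse g one = h zero by rewrite reverse1.
have crgh := concat_continuous crg ch rgh.
have grg : g one = reverse g zero by rewrite reverse0.
apply: path_homotopic_trans.
  by apply: path_homotopic_concatA; rewrite ?concat0.
apply: path_homotopic_concat; rewrite ?concat0//; first exact: path_homotopic_refl.
apply: path_homotopic_trans.
  by apply: path_homotopic_sym; apply: path_homotopic_concatA.
apply: path_homotopic_trans.
  apply: path_homotopic_concat; last exact: path_homotopic_refl ch.
    by rewrite concat1.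
  exact: path_homotopic_concatV.
by rewrite -hg; exact: path_homotopic_concat_cstl.
Qed.

End concatenation.

Lemma path_cts (R : realType) (X : topologicalType) (x y : X)
  (p : {path unit_interval R from x to y}) : continuous p.
Proof. exact: cts_fun. Qed.

Section concat_path.
Variables (R : realType) (X : topologicalType) (x y z : X).
Local Notation I := (unit_interval R).

Section concat.
Variables (p : {path I from x to y}) (q : {path I from y to z}).

Let concat_path_cts : continuous (concat p q).
Proof.
by apply: concat_continuous; [exact: path_cts|exact: path_cts|
  rewrite path_one path_zero].
Qed.

Let concat_path_zero : concat p q zero = x.
Proof. by rewrite concat0 path_zero. Qed.

Let concat_path_one : concat p q one = z.
Proof. by rewrite concat1 path_one. Qed.

HB.instance Definition _ := isContinuous.Build I X (concat p q) concat_path_cts.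
HB.instance Definition _ :=
  isPath.Build I X x z (concat p q) concat_path_zero concat_path_one.
End concat.

Section reverse.
Variable p : {path I from x to y}.

Let reverse_path_cts : continuous (reverse p).
Proof. by apply: reverse_continuous; exact: path_cts. Qed.

Let reverse_path_zero : reverse p zero = y.
Proof. by rewrite reverse0 path_one. Qed.

Let reverse_path_one : reverse p one = x.
Proof. by rewrite reverse1 path_zero. Qed.

HB.instance Definition _ := isContinuous.Build I X (reverse p) reverse_path_cts.
HB.instance Definition _ :=
  isPath.Build I X y x (reverse p) reverse_path_zero reverse_path_one.
End reverse.

End concat_path.

Section fundamental_group.
Variables (R : realType) (X : topologicalType) (x0 : X).
Local Notation I := (unit_interval R).

Definition loop : Type := {path I from x0 to x0}.
HB.instance Definition _ := Topological.copy loop {path I from x0 to x0}.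

Definition loop_homotopic (p q : loop) : bool :=
  `[< path_homotopic (p : {path I from x0 to x0}) (q : {path I from x0 to x0}) >].

Lemma loop_homotopic_refl : reflexive loop_homotopic.
Proof. by move=> p; apply/asboolP/path_homotopic_refl; exact: path_cts. Qed.

Lemma loop_homotopic_sym : symmetric loop_homotopic.
Proof.
move=> p q; apply/idP/idP => /asboolP pq; apply/asboolP;
  exact: path_homotopic_sym.
Qed.

Lemma loop_homotopic_trans : transitive loop_homotopic.
Proof.
move=> q p r /asboolP pq /asboolP qr; apply/asboolP.
exact: path_homotopic_trans pq qr.
Qed.

Canonical loop_homotopic_equiv := EquivRel loop_homotopic
  loop_homotopic_refl loop_homotopic_sym loop_homotopic_trans.

Definition pi1 : Type := {eq_quot loop_homotopic}.
HB.instance Definition _ := Choice.on pi1.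
HB.instance Definition _ := EqQuotient.on pi1.

Definition pi1_class (p : {path I from x0 to x0}) : pi1 := \pi_pi1 (p : loop).

Lemma pi1_classP (p q : {path I from x0 to x0}) :
  pi1_class p = pi1_class q <-> path_homotopic p q.
Proof.
split; first by move/eqquotP/asboolP.
by move=> pq; apply/eqquotP/asboolP.
Qed.

Definition pi1_repr (a : pi1) : {path I from x0 to x0} := repr a.

Lemma pi1_reprK a : pi1_class (pi1_repr a) = a.
Proof. exact: reprK. Qed.

Definition pi1_one : pi1 := pi1_class (cst x0).
Definition pi1_inv (a : pi1) : pi1 := pi1_class (reverse (pi1_repr a)).
Definition pi1_mul (a b : pi1) : pi1 :=
  pi1_class (concat (pi1_repr a) (pi1_repr b)).

Lemma pi1_mulE p q : pi1_mul (pi1_class p) (pi1_class q) = pi1_class (concat p q).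
Proof.
apply/pi1_classP/path_homotopic_concat; first by rewrite path_one path_zero.
- by apply/pi1_classP; rewrite pi1_reprK.
- by apply/pi1_classP; rewrite pi1_reprK.
Qed.

Lemma pi1_invE p : pi1_inv (pi1_class p) = pi1_class (reverse p).
Proof.
apply/pi1_classP/path_homotopic_reverse.
by apply/pi1_classP; rewrite pi1_reprK.
Qed.

Lemma pi1_mulA : associative pi1_mul.
Proof.
move=> a b c; rewrite -[a]pi1_reprK -[b]pi1_reprK -[c]pi1_reprK !pi1_mulE.
by apply/pi1_classP/path_homotopic_sym/path_homotopic_concatA;
  rewrite ?path_one ?path_zero//; exact: path_cts.
Qed.

Lemma pi1_mul1g : left_id pi1_one pi1_mul.
Proof.
move=> a; rewrite -[a]pi1_reprK pi1_mulE; apply/pi1_classP.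
have := path_homotopic_concat_cstl (@path_cts _ _ _ _ (pi1_repr a)).
by rewrite path_zero.
Qed.

Lemma pi1_mulg1 : right_id pi1_one pi1_mul.
Proof.
move=> a; rewrite -[a]pi1_reprK pi1_mulE; apply/pi1_classP.
have := path_homotopic_concat_cstr (@path_cts _ _ _ _ (pi1_repr a)).
by rewrite path_one.
Qed.

Lemma pi1_mulgV : right_inverse pi1_one pi1_inv pi1_mul.
Proof.
move=> a; rewrite -[a]pi1_reprK pi1_invE pi1_mulE; apply/pi1_classP.
have := path_homotopic_concatV (@path_cts _ _ _ _ (pi1_repr a)).
by rewrite path_zero.
Qed.

Lemma pi1_mulVg : left_inverse pi1_one pi1_inv pi1_mul.
Proof.
move=> a; rewrite -[RHS](pi1_mulgV (pi1_inv a)); congr (pi1_mul _ _).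
rewrite -[a]pi1_reprK !pi1_invE; apply/pi1_classP; rewrite /= reverseK.
exact: path_homotopic_refl (@path_cts _ _ _ _ _).
Qed.

HB.instance Definition _ :=
  isGroup.Build pi1 pi1_mulA pi1_mul1g pi1_mulg1 pi1_mulVg pi1_mulgV.

(* The quotient of the loop space, which carries the compact-open topology. *)
Definition pi1_qtop : Type := quotient_topology pi1.
HB.instance Definition _ := Topological.on pi1_qtop.

End fundamental_group.

Record based_path (R : realType) (X : topologicalType) (x0 : X) := BasedPath {
  bpath :> unit_interval R -> X;
  bpath_cts : continuous bpath;
  bpath0 : bpath zero = x0
}.

Section based_path.
Variables (R : realType) (X : topologicalType) (x0 : X).
Local Notation I := (unit_interval R).

HB.instance Definition _ := gen_eqMixin (based_path R x0).
HB.instance Definition _ := gen_choiceMixin (based_path R x0).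
HB.instance Definition _ := isPointed.Build (based_path R x0)
  (BasedPath (@cst_continuous I X x0) erefl).

HB.instance Definition _ (a : based_path R x0) :=
  isContinuous.Build I X (bpath a) (@bpath_cts _ _ _ a).
HB.instance Definition _ (a : based_path R x0) :=
  isPath.Build I X x0 (a one) (bpath a) (bpath0 a) erefl.

Definition based_concat (a : based_path R x0) (y : X)
    (b : {path I from (a one) to y}) : based_path R x0 :=
  BasedPath (@path_cts _ _ _ _ (concat a b)) (@path_zero _ _ _ _ (concat a b)).

End based_path.

Section whisker.
Variables (R : realType) (X : topologicalType) (x0 : X).
Local Notation I := (unit_interval R).
Variable H : groupClosed (pi1 R x0).

Definition loop_class_in (f : I -> X) : Prop :=
  exists2 p : {path I from x0 to x0}, p = f :> (I -> X) & pi1_class p \in H.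

Lemma loop_class_in_homotopic f g :
  continuous g -> path_homotopic f g -> loop_class_in f -> loop_class_in g.
Proof.
move=> cg fg [p pf pH]; have [fg0 fg1] := path_homotopic_ends fg.
have g0 : g zero = x0 by rewrite -fg0 -pf path_zero.
have g1 : g one = x0 by rewrite -fg1 -pf path_one.
pose q : {path I from x0 to x0} := mk_path cg g0 g1.
exists q => //; suff -> : pi1_class q = pi1_class p by [].
by apply/pi1_classP/path_homotopic_sym; rewrite pf.
Qed.

Lemma loop_class_in1 : loop_class_in (cst x0).
Proof. by exists (cst x0) => //; exact: (@gpred1 _ H). Qed.

Lemma loop_class_inV f : loop_class_in f -> loop_class_in (reverse f).
Proof.
case=> p pf pH; exists (reverse p); first by rewrite /= pf.
by rewrite -pi1_invE; exact: gpredVr.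
Qed.

Lemma loop_class_inM f g :
  loop_class_in f -> loop_class_in g -> loop_class_in (concat f g).
Proof.
case=> p pf pH [q qg qH]; exists (concat p q); first by rewrite /= pf qg.
by rewrite -pi1_mulE; exact: gpredM.
Qed.

Definition lift_rel (a b : based_path R x0) : bool :=
  `[< a one = b one /\ loop_class_in (concat a (reverse b)) >].

Lemma homotopic_lift_rel (a b : based_path R x0) :
  path_homotopic a b -> lift_rel a b.
Proof.
move=> ab; have [_ ab1] := path_homotopic_ends ab.
apply/asboolP; split=> //.
have ca := @bpath_cts _ _ _ a; have cb := @bpath_cts _ _ _ b.
apply: (loop_class_in_homotopic _ _ loop_class_in1).
  by apply: concat_continuous; rewrite ?reverse0//; exact: reverse_continuous.
apply: path_homotopic_sym.
have := path_homotopic_concatV cb; rewrite bpath0; apply: path_homotopic_trans.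
apply: path_homotopic_concat => //; first by rewrite reverse0.
by apply: path_homotopic_refl; exact: reverse_continuous.
Qed.

Lemma lift_rel_refl : reflexive lift_rel.
Proof.
by move=> a; apply/homotopic_lift_rel/path_homotopic_refl; exact: bpath_cts.
Qed.

Lemma lift_rel_sub a b : lift_rel a b -> lift_rel b a.
Proof.
move=> /asboolP[ab abH]; apply/asboolP; split=> //.
by move/loop_class_inV : abH; rewrite reverse_concat ?reverse0// reverseK.
Qed.

Lemma lift_rel_sym : symmetric lift_rel.
Proof. by move=> a b; apply/idP/idP => /lift_rel_sub. Qed.

Lemma lift_rel_trans : transitive lift_rel.
Proof.
move=> b a c /asboolP[ab abH] /asboolP[bc bcH]; apply/asboolP.
split; first by rewrite ab.
have ca := @bpath_cts _ _ _ a; have cb := @bpath_cts _ _ _ b.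
have cc := @bpath_cts _ _ _ c.
apply: loop_class_in_homotopic (loop_class_inM abH bcH).
  apply: concat_continuous; rewrite ?reverse0 ?ab//.
  exact: reverse_continuous.
rewrite -{2}(reverseK b); apply: path_homotopic_cancel => //.
- exact: reverse_continuous.
- exact: reverse_continuous.
- by rewrite reverse0.
- by rewrite !reverse0 bc.
Qed.

Lemma lift_rel_concat (a b c d : based_path R x0) (e : I -> X) :
  continuous e -> a one = e zero ->
  c = concat a e :> (I -> X) -> d = concat b e :> (I -> X) ->
  lift_rel a b -> lift_rel c d.
Proof.
move=> ce ae cae dbe /asboolP[ab abH]; apply/asboolP.
split; first by rewrite cae dbe !concat1.
have ca := @bpath_cts _ _ _ a; have cb := @bpath_cts _ _ _ b.
have crb := reverse_continuous cb.
apply: loop_class_in_homotopic abH; rewrite cae dbe reverse_concat -?ab//.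
  apply: concat_continuous; rewrite ?concat0 ?concat1 ?reverse0//.
  - exact: concat_continuous.
  - apply: concat_continuous => //; first exact: reverse_continuous.
    by rewrite reverse0 reverse1 -ab.
apply: path_homotopic_sym; apply: path_homotopic_cancel => //.
by rewrite reverse0 -ab.
Qed.

Canonical lift_rel_equiv := EquivRel lift_rel
  lift_rel_refl lift_rel_sym lift_rel_trans.

Definition lift_space : Type := {eq_quot lift_rel}.
HB.instance Definition _ := Choice.on lift_space.
HB.instance Definition _ := EqQuotient.on lift_space.

Definition lift_class (a : based_path R x0) : lift_space := \pi_lift_space a.

Lemma lift_classP a b : lift_class a = lift_class b <-> lift_rel a b.
Proof. by split=> [/eqquotP//|ab]; exact/eqquotP. Qed.

Definition endpoint (q : lift_space) : X := (repr q : based_path R x0) one.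

Lemma endpointE a : endpoint (lift_class a) = a one.
Proof.
suff /asboolP[] : lift_rel (repr (lift_class a)) a by [].
by apply/lift_classP; exact: reprK.
Qed.

Definition whisker_basic (a : based_path R x0) (U : set X) : set lift_space :=
  [set q | exists (y : X) (b : {path I from (a one) to y}),
     range b `<=` U /\ q = lift_class (based_concat b)].

Definition whisker_index : set (based_path R x0 * set X) :=
  [set i : based_path R x0 * set X | open_nbhs (i.1 one) i.2].

Definition whisker_base (i : based_path R x0 * set X) : set lift_space :=
  whisker_basic i.1 i.2.

Lemma whisker_basic_self (a : based_path R x0) (U : set X) : U (a one) -> whisker_basic a U (lift_class a).
Proof.
move=> Ua; exists (a one), (cst (a one)); split; first by move=> _ [t _ <-].
apply/lift_classP/homotopic_lift_rel/path_homotopic_sym.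
by apply: path_homotopic_concat_cstr; exact: bpath_cts.
Qed.

Lemma whisker_basic_end (a : based_path R x0) (U : set X) q : whisker_basic a U q -> U (endpoint q).
Proof.
case=> y [b [bU ->]]; rewrite endpointE /= concat1.
by apply: bU; exists one.
Qed.

Lemma whisker_basic_sub (a c : based_path R x0) (U V : set X) : V `<=` U ->
  whisker_basic a U (lift_class c) -> whisker_basic c V `<=` whisker_basic a U.
Proof.
move=> VU [y [b [bU /lift_classP cab]]] _ [z [e [eV ->]]].
have cE : c one = y by move/asboolP : (cab) => [-> _]; rewrite /= concat1 path_one.
have e0 : e zero = y by rewrite path_zero.
pose e' : {path I from y to z} := mk_path (@path_cts _ _ _ _ e) e0 (@path_one _ _ _ _ e).
exists z, (concat b e'); split.
  move=> _ [t _ <-]; rewrite /= /concat; case: ifP => _; first by apply: bU; eexists.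
  by apply/VU/eV; eexists.
apply/lift_classP.
have /lift_rel_trans : lift_rel (based_concat e)
    (based_concat (a := based_concat b) (mk_path (@path_cts _ _ _ _ e)
       (etrans e0 (esym (etrans (concat1 a b) (@path_one _ _ _ _ b))))
       (@path_one _ _ _ _ e))).
  apply: (lift_rel_concat (e := e)) cab => //; first exact: path_cts.
  by rewrite e0 cE.
apply; apply: homotopic_lift_rel.
apply: path_homotopic_concatA; rewrite ?path_one ?path_zero//.
- exact: bpath_cts.
- exact: path_cts.
- exact: (@path_cts _ _ _ _ e).
- exact: etrans (@path_one _ _ _ _ b) (esym e0).
Qed.

Lemma whisker_base_cover : \bigcup_(i in whisker_index) whisker_base i = setT.
Proof.
apply/seteqP; split => // q _.
exists ((repr q : based_path R x0), setT); first by split => //; exact: openT.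
by rewrite -{2}[q]reprK; exact: whisker_basic_self.
Qed.

Lemma whisker_base_join i j q : whisker_index i -> whisker_index j ->
  whisker_base i q -> whisker_base j q ->
  exists k, [/\ whisker_index k, whisker_base k q &
    whisker_base k `<=` whisker_base i `&` whisker_base j].
Proof.
case: i j => [a U] [b V] [/= oU _] [oV _] qU qV.
have qE : lift_class (repr q) = q by exact: reprK.
have UVq : (U `&` V) ((repr q : based_path R x0) one).
  by split; [exact: whisker_basic_end qU|exact: whisker_basic_end qV].
exists ((repr q : based_path R x0), U `&` V); split.
- by split => //; exact: openI.
- by rewrite /whisker_base/= -{2}qE; exact: whisker_basic_self.
- move=> r qr; split.
  + by apply: whisker_basic_sub qr; [exact: subIsetl|rewrite qE].
  + by apply: whisker_basic_sub qr; [exact: subIsetr|rewrite qE].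
Qed.

(* The quotient above with the whisker topology, not the quotient topology. *)
Definition whisker : Type := lift_space.
HB.instance Definition _ := Choice.on whisker.
HB.instance Definition _ :=
  isBaseTopological.Build whisker whisker_base_cover whisker_base_join.

Definition endpoint_proj (q : whisker) : X := endpoint q.

End whisker.
Arguments whisker_basic {R X x0} H a U.

Section notions.
Variables (R : realType) (X : topologicalType).
Local Notation I := (unit_interval R).

Definition path_connected_in (A : set X) : Prop :=
  forall x y, A x -> A y ->
    exists p : {path I from x to y}, range p `<=` A.

Definition path_connected : Prop := path_connected_in setT.

Definition locally_path_connected : Prop :=
  forall (x : X) (U : set X), open_nbhs x U ->
    exists V : set X, [/\ open_nbhs x V, V `<=` U & path_connected_in V].

Definition slt_at (x0 : X) : Prop :=
  forall (y : X) (a : {path I from x0 to y}) (U : set X), nbhs x0 U ->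
    exists2 V : set X, nbhs y V &
      forall b : {path I from y to y}, range b `<=` V ->
        exists2 g : {path I from x0 to x0}, range g `<=` U &
          path_homotopic g (concat (concat a b) (reverse a)).

Definition unique_path_lifting (E : topologicalType) (p : E -> X) : Prop :=
  forall f g : I -> E, continuous f -> continuous g ->
    f zero = g zero -> p \o f = p \o g -> f = g.

End notions.

Definition normal_subgroup (G : groupType) (H : {pred G}) : Prop :=
  forall g h : G, h \in H -> (h ^ g)%g \in H.

(* Main.v *)
Require Import Defs.
From HB Require Import structures.
From mathcomp Require Import all_boot all_order all_algebra.
From mathcomp Require Import generic_quotient.
From mathcomp Require Import all_classical all_reals topology normedtype homotopy.
From mathcomp Require Import ring lra.

Set Implicit Arguments.
Unset Strict Implicit.
Unset Printing Implicit Defensive.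

Import Order.TTheory GRing.Theory Num.Theory.
Import numFieldNormedType.Exports.

Local Open Scope classical_set_scope.

(** Choosing a path from x0 to every point turns each path f of X into an element
hol f of pi_1(X, x0), multiplicatively for concatenation; two elements of P(X, x0)
with the same end are then equivalent modulo H exactly when their values differ
by an element of H. All homotopies thereby become computations in one group.

For a neighborhood W of x0, the set mod_small W of products of a class of a loop
in W by an element of H is a subgroup, because H is normal. Both sides of the
equivalence say that H is the intersection of these subgroups.

- Unique lifting forces it ([upl_mem]): an element a of all of them lies in every
  whisker neighborhood of the base point, so the path that jumps at time 0 from
  the base point to the point of the fibre given by a is continuous, and it
  lies over a constant path.
- It gives unique lifting ([lifts_mod_small]): for two lifts f and g of one path
  with a common start, the quotient of the classes of f(t) and g(t) moves, for
  small changes of t, by a small loop at the current point transported to x0.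
  SLT makes the transported loop small at x0, so membership of the quotient in
  mod_small W is a locally constant condition on t; it holds at 0.
- A closed H has it ([mem_of_mod_small]): multiplying a loop by loops that
  shrink to x0 is continuous for the compact-open topology.
- It makes H closed ([mod_small_closed]): under SLT and local path connectedness
  a loop q that is close to p in the compact-open topology differs from p by a
  loop in W ([nearby_loops]). This is where the two topologies on the fundamental
  group are compared, again by a locally constant condition on [0, 1]. *)

(** * Paths and the unit interval *)

Section paths.
Variables (R : realType) (X : topologicalType).
Local Notation I := (unit_interval R).

Lemma range_concat_subset (f g : I -> X) (U : set X) :
  range f `<=` U -> range g `<=` U -> range (concat f g) `<=` U.
Proof.
move=> fU gU _ [t _ <-]; rewrite /concat.
by case: ifP => _; [apply: fU|apply: gU]; eexists.
Qed.

Lemma range_reverse_subset (f : I -> X) (U : set X) :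
  range f `<=` U -> range (reverse f) `<=` U.
Proof. by move=> fU _ [t _ <-]; apply: fU; eexists. Qed.

Lemma clamp_continuous : continuous (clamp : R -> I).
Proof. apply: (@clamp_comp_continuous R R idfun) => x; exact: cvg_id. Qed.

(** Connectedness of the interval in the form that replaces subdivisions: to
propagate a property along a path it suffices to propagate it between nearby
parameters, in both directions. *)
Lemma locally_constant_interval (P : I -> Prop) :
  (forall t, \forall s \near t, P s <-> P t) -> P zero -> forall t, P t.
Proof.
move=> lcP P0 t; pose A : set R := [set x | P (clamp x)].
have lcA x : \forall y \near x, A y <-> A x.
  exact: (clamp_continuous (lcP (clamp x))).
suff AT : A = setT by rewrite -(ivalK t); suff : A (ival t) by []; rewrite AT.
have : connected [set: R] by apply/connected_intervalP.
apply.
- by exists 0%R.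
- exists A; last by rewrite setTI.
  by rewrite openE => x Ax; apply: filterS (lcA x) => y [_]; exact.
- exists A; last by rewrite setTI.
  rewrite -[A]setCK; apply: open_closedC; rewrite openE => x nAx.
  by apply: filterS (lcA x) => y [Ayx _] /Ayx.
Qed.

Lemma compact_unit_interval : compact [set: I].
Proof.
rewrite (_ : setT = clamp @` (`[0%R, 1%R] : set R)); last first.
  apply/seteqP; split => // t _; exists (ival t); rewrite ?ivalK//=.
  by rewrite in_itv/= ival_ge0 ival_le1.
apply: continuous_compact; last exact: segment_compact.
exact/continuous_subspaceT/clamp_continuous.
Qed.

Definition line (s t u : I) : I := clamp ((1 - ival u) * ival s + ival u * ival t)%R.

Lemma line_continuous s t : continuous (line s t).
Proof.
have -> : line s t = fun u => clamp ((ival t - ival s) * ival u + ival s)%R.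
  by apply/funext => u; congr clamp; ring.
exact: affine_continuous.
Qed.

Lemma line_bounds s t u (m M : R) : (m < ival s < M)%R -> (m < ival t < M)%R ->
  (m < ival (line s t u) < M)%R.
Proof.
have s0 := ival_ge0 s; have s1 := ival_le1 s.
have t0 := ival_ge0 t; have t1 := ival_le1 t.
have u0 := ival_ge0 u; have u1 := ival_le1 u.
move=> /andP[sm sM] /andP[tm tM].
have [st|ts] := lerP (ival s) (ival t).
- have ut : (0 <= ival u * (ival t - ival s))%R by rewrite mulr_ge0 ?subr_ge0.
  have vt : (0 <= (1 - ival u) * (ival t - ival s))%R by rewrite mulr_ge0 ?subr_ge0.
  by rewrite clampE; lra.
- have ut : (0 <= ival u * (ival s - ival t))%R by rewrite mulr_ge0 ?subr_ge0// ltW.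
  have vt : (0 <= (1 - ival u) * (ival s - ival t))%R.
    by rewrite mulr_ge0 ?subr_ge0// ltW.
  by rewrite clampE; lra.
Qed.

Lemma line0 s t : line s t zero = s.
Proof. by rewrite /line ival0 subr0 mul1r mul0r addr0 ivalK. Qed.

Lemma line1 s t : line s t one = t.
Proof. by rewrite /line ival1 subrr mul1r mul0r add0r ivalK. Qed.

Lemma line01 : line zero one = id.
Proof. by apply/funext => u; rewrite /line ival0 ival1 mulr0 add0r mulr1 ivalK. Qed.

Lemma line_cst s : line s s = cst s.
Proof. by apply/funext => u; rewrite /line -mulrDl subrK mul1r ivalK. Qed.

(** The topology on loops is induced from all functions, so the subbasic sets of
the compact-open topology have to be pulled back. *)
Lemma open_loops_mapping (x0 : X) (K : set I) (O : set X) : compact K -> open O ->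
  open [set q : loop R x0 | (q : {path I from x0 to x0}) @` K `<=` O].
Proof.
by move=> cK oO; exists [set g | g @` K `<=` O] => //; exact: compact_open_open.
Qed.

End paths.
Arguments line_continuous {R} s t.

(** * The fundamental group as a group of values for all paths *)

Section holonomy.
Variables (R : realType) (X : topologicalType) (x0 : X).
Local Notation I := (unit_interval R).
Local Notation G := (pi1 R x0).
Variable k : X -> I -> X.
Hypothesis k_cts : forall x, continuous (k x).
Hypothesis k_zero : forall x, k x zero = x0.
Hypothesis k_one : forall x, k x one = x.
Hypothesis k_base : k x0 = cst x0.

(** The homotopy class, made total on raw functions: the value 1 off the loops at
x0 is never met, but this avoids carrying endpoint proofs inside paths. *)
Definition loop_value (f : I -> X) : G :=
  xget 1%g [set a | exists2 p : {path I from x0 to x0},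
    p = f :> (I -> X) & pi1_class p = a].

Lemma loop_valueE (p : {path I from x0 to x0}) : loop_value p = pi1_class p.
Proof.
rewrite /loop_value.
case: xgetP => [a _ [q qp <-]|/(_ (pi1_class p))[]]; last by exists p.
by congr pi1_class; apply/path_eqP => t; rewrite qp.
Qed.

Lemma loop_value_homotopic f g : f zero = x0 -> f one = x0 ->
  continuous f -> continuous g -> path_homotopic f g -> loop_value f = loop_value g.
Proof.
move=> f0 f1 cf cg fg; have [fg0 fg1] := path_homotopic_ends fg.
rewrite -[f]/(mk_path cf f0 f1 : _ -> _) loop_valueE.
rewrite -[g]/(mk_path cg (etrans (esym fg0) f0) (etrans (esym fg1) f1) : _ -> _).
by rewrite loop_valueE; apply/pi1_classP.
Qed.

Lemma loop_value_concat f g : f zero = x0 -> f one = x0 -> g zero = x0 -> g one = x0 ->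
  continuous f -> continuous g ->
  loop_value (concat f g) = (loop_value f * loop_value g)%g.
Proof.
move=> f0 f1 g0 g1 cf cg.
rewrite -[f]/(mk_path cf f0 f1 : _ -> _) -[g]/(mk_path cg g0 g1 : _ -> _).
by rewrite !loop_valueE -[LHS]pi1_mulE.
Qed.

(** The chosen paths k trivialize the fundamental groupoid: this is the induced
functor to the vertex group at x0, which is faithful on paths with given ends. *)
Definition hol (f : I -> X) : G :=
  loop_value (concat (concat (k (f zero)) f) (reverse (k (f one)))).

Let conj_cts f : continuous f -> continuous (concat (k (f zero)) f).
Proof. by move=> cf; apply: concat_continuous. Qed.

Let rk_cts x : continuous (reverse (k x)).
Proof. exact: reverse_continuous. Qed.

Lemma hol_homotopic f g : continuous f -> continuous g -> path_homotopic f g ->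
  hol f = hol g.
Proof.
move=> cf cg fg; have [fg0 fg1] := path_homotopic_ends fg.
apply: loop_value_homotopic.
- by rewrite !concat0.
- by rewrite concat1 reverse1.
- by apply: concat_continuous; rewrite ?concat1 ?reverse0//; exact: conj_cts.
- by apply: concat_continuous; rewrite ?concat1 ?reverse0//; exact: conj_cts.
- rewrite -fg0 -fg1; apply: path_homotopic_concat; first by rewrite concat1 reverse0.
    apply: path_homotopic_concat => //; exact: path_homotopic_refl.
  exact: path_homotopic_refl.
Qed.

Lemma hol_concat f g : continuous f -> continuous g -> f one = g zero ->
  hol (concat f g) = (hol f * hol g)%g.
Proof.
move=> cf cg fg.
have ckf := conj_cts cf; have ckg := conj_cts cg.
have cr := @rk_cts (g one).
have cgr : continuous (concat g (reverse (k (g one)))).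
  by apply: concat_continuous; rewrite ?reverse0.
have cfg := concat_continuous cf cg fg.
have ckfr : continuous (concat (concat (k (f zero)) f) (reverse (k (f one)))).
  by apply: concat_continuous; rewrite ?concat1 ?reverse0//; exact: rk_cts.
have ckgr : continuous (concat (concat (k (g zero)) g) (reverse (k (g one)))).
  by apply: concat_continuous; rewrite ?concat1 ?reverse0.
rewrite /hol -loop_value_concat //; last first.
- by rewrite concat1 reverse1.
- by rewrite !concat0.
- by rewrite concat1 reverse1.
- by rewrite !concat0.
apply/esym/loop_value_homotopic.
- by rewrite !concat0.
- by rewrite !concat1 reverse1.
- by apply: concat_continuous; rewrite // concat1 reverse1 !concat0 !k_zero.
- apply: concat_continuous; rewrite ?concat0 ?concat1 ?reverse0//.
  by apply: concat_continuous; rewrite ?concat0.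
rewrite concat0 concat1.
(* Both sides are (k f) (g k^-1), up to association and a cancelled k^-1 k. *)
pose kf := concat (k (f zero)) f; pose gr := concat g (reverse (k (g one))).
apply: (@path_homotopic_trans _ _ (concat kf gr)).
  apply: (@path_homotopic_trans _ _ (concat (concat kf (reverse (k (f one))))
     (concat (reverse (reverse (k (f one)))) gr))).
    apply: path_homotopic_concat; rewrite ?concat0 ?concat1 ?reverse1 ?k_zero//.
      exact: path_homotopic_refl.
    rewrite reverseK fg; apply: path_homotopic_concatA => //.
    by rewrite reverse0.
  by apply: path_homotopic_cancel; rewrite /kf /gr ?concat0 ?concat1 ?reverse0 ?k_one.
rewrite /kf /gr; apply: path_homotopic_trans; first apply: path_homotopic_sym.
  by apply: path_homotopic_concatA; rewrite ?concat1 ?reverse0.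
apply: path_homotopic_concat; rewrite ?concat1 ?reverse0//.
  by apply: path_homotopic_concatA.
exact: path_homotopic_refl.
Qed.

Lemma hol_cst x : hol (cst x) = 1%g.
Proof.
have cx : continuous (cst x : I -> X) by exact: cst_continuous.
apply: (mulgI (hol (cst x))); rewrite mulg1 -hol_concat//.
apply: hol_homotopic => //; first exact: concat_continuous.
exact: (path_homotopic_concat_cstl cx).
Qed.

Lemma hol_reverse f : continuous f -> hol (reverse f) = (hol f)^-1%g.
Proof.
move=> cf; have crf := reverse_continuous cf.
apply/esym/mulg1_eq; rewrite -hol_concat ?reverse0// -(hol_cst (f zero)).
apply: hol_homotopic; last exact: path_homotopic_concatV.
  by apply: concat_continuous; rewrite ?reverse0.
exact: cst_continuous.
Qed.

(** The only use of the normalization k x0 = cst x0; otherwise the two sides would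
be conjugate. *)
Lemma hol_loop (p : {path I from x0 to x0}) : hol p = pi1_class p.
Proof.
have cp := @path_cts _ _ _ _ p.
rewrite -loop_valueE /hol path_zero path_one k_base.
have -> : reverse (cst x0) = cst x0 :> (I -> X) by [].
have c0 : continuous (cst x0 : I -> X) by exact: cst_continuous.
apply: loop_value_homotopic => //.
- by rewrite concat0 concat0.
- by rewrite concat1.
- apply: concat_continuous => //; rewrite ?concat1 ?path_one//.
  by apply: concat_continuous; rewrite ?path_zero.
apply: (@path_homotopic_trans _ _ (concat p (cst x0))).
  apply: path_homotopic_concat; rewrite ?concat1 ?path_one//.
    by have := path_homotopic_concat_cstl cp; rewrite path_zero.
  exact: path_homotopic_refl.
by have := path_homotopic_concat_cstr cp; rewrite path_one.
Qed.

Lemma hol_reparam f (phi psi : I -> I) :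
  continuous f -> continuous phi -> continuous psi ->
  phi zero = psi zero -> phi one = psi one -> hol (f \o phi) = hol (f \o psi).
Proof.
move=> cf cphi cpsi e0 e1; apply: hol_homotopic; last exact: path_homotopic_reparam.
  exact: continuous_compT cphi cf.
exact: continuous_compT cpsi cf.
Qed.

(** The stretches of f between r, s and t need not be in increasing order: up to
reparametrization only the ends of a path in the interval matter. *)
Lemma hol_line_concat f r s t : continuous f ->
  (hol (f \o line r s) * hol (f \o line s t))%g = hol (f \o line r t).
Proof.
move=> cf; have c1 := continuous_compT (line_continuous r s) cf.
have c2 := continuous_compT (line_continuous s t) cf.
rewrite -hol_concat//=; last by rewrite line1 line0.
have -> : concat (f \o line r s) (f \o line s t) = f \o concat (line r s) (line s t).
  by apply/funext => u; rewrite /concat/=; case: ifP.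
apply: hol_reparam => //.
- by apply: concat_continuous; [exact: line_continuous..|rewrite line1 line0].
- exact: line_continuous.
- by rewrite concat0 !line0.
- by rewrite concat1 !line1.
Qed.

(** The values of the paths in U from x to y; the laws below are those of the
groupoid of paths in U, and via W x0 x0 is the image of pi_1(W, x0). *)
Definition via (U : set X) (x y : X) (g : G) : Prop :=
  exists f : I -> X,
    [/\ continuous f, range f `<=` U, f zero = x, f one = y & hol f = g].

Lemma via_sub U V x y g : U `<=` V -> via U x y g -> via V x y g.
Proof.
by move=> UV [f [cf /subset_trans fU f0 f1 fg]]; exists f; split=> //; exact: fU.
Qed.

Lemma via1 (U : set X) x : U x -> via U x x 1%g.
Proof.
move=> Ux; exists (cst x); split => //; last exact: hol_cst.
  exact: cst_continuous.
by move=> _ [t _ <-].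
Qed.

Lemma viaM U x y z g h : via U x y g -> via U y z h -> via U x z (g * h)%g.
Proof.
move=> [f [cf fU f0 f1 <-]] [e [ce eU e0 e1 <-]]; exists (concat f e).
have fe : f one = e zero by rewrite f1 e0.
split; rewrite ?concat0 ?concat1//; last exact: hol_concat.
  exact: concat_continuous.
exact: range_concat_subset.
Qed.

Lemma viaV U x y g : via U x y g -> via U y x g^-1%g.
Proof.
move=> [f [cf fU f0 f1 <-]]; exists (reverse f).
split; rewrite ?reverse0 ?reverse1//; last exact: hol_reverse.
  exact: reverse_continuous.
exact: range_reverse_subset.
Qed.

Lemma via_hol (f : I -> X) : continuous f -> via setT (f zero) (f one) (hol f).
Proof. by move=> cf; exists f. Qed.


Lemma path_connected_in_via (V : set X) x y : path_connected_in R V -> V x -> V y ->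
  exists g, via V x y g.
Proof.
move=> pcV Vx Vy; have [p pV] := pcV _ _ Vx Vy.
by exists (hol p), p; split; rewrite ?path_zero ?path_one//; exact: path_cts.
Qed.

Lemma slt_via y a (U : set X) : slt_at R x0 -> via setT x0 y a -> nbhs x0 U ->
  exists2 V, nbhs y V & forall b, via V y y b -> via U x0 x0 (a * b * a^-1)%g.
Proof.
move=> slt [f [cf _ f0 f1 <-]] Ux0.
have [V Vy VU] := slt y (mk_path cf f0 f1) U Ux0.
exists V => // b [e [ce eV e0 e1 <-]].
have [g gU gE] := VU (mk_path ce e0 e1) eV; exists g.
have fe : f one = e zero by rewrite f1 e0.
have cfe := concat_continuous cf ce fe.
have crf := reverse_continuous cf.
have fer : concat f e one = reverse f zero by rewrite concat1 reverse0 f1 e1.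
split; rewrite ?path_zero ?path_one//; first exact: path_cts.
rewrite (hol_homotopic _ _ gE); first last.
- exact: concat_continuous cfe crf fer.
- exact: path_cts.
by rewrite (hol_concat cfe crf fer) (hol_concat cf ce fe) (hol_reverse cf).
Qed.

(** * Close loops differ by small loops *)

(** Compare q with p along the way: joining q t to p t by a short path g, the loop
that follows q up to t, then g backwards, then p backwards should be small at x0.
Moving t within a region where p and q stay in a path connected set V' changes
this loop by a loop in V' at p t, transported to x0 along p; SLT applied to p up
to t says that such loops are small at x0. *)
Lemma nearby_loops (p : {path I from x0 to x0}) (W : set X) :
  locally_path_connected R X -> slt_at R x0 -> nbhs x0 W ->
  nbhs (p : loop R x0)
    [set q | via W x0 x0 (hol (q : {path I from x0 to x0}) / hol p)%g].
Proof.
move=> lpc slt Wx0; have cp := @path_cts _ _ _ _ p.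
(* C keeps the joining path g short. The neighborhood N of p depends on t; only
   the one obtained at the end of the interval is used. *)
pose tracks t := exists N C, [/\ nbhs (p : loop R x0) N, open_nbhs (p t) C &
  forall (q : {path I from x0 to x0}) g, N q -> via C (p t) (q t) g ->
  via W x0 x0 (hol (q \o line zero t) * g^-1 * (hol (p \o line zero t))^-1)%g].
suff /(_ one)[N [C [Np [_ Cp1] NW]]] : forall t, tracks t.
  apply: filterS Np => q /(NW q 1%g).
  have whole (f : {path I from x0 to x0}) : f \o line zero one = f :> (I -> X).
    by rewrite line01.
  rewrite !whole invg1 mulg1; apply.
  by rewrite !path_one in Cp1 *; exact: via1.
apply: locally_constant_interval => [t|]; last first.
  exists setT, W^°; split; first exact: filterT.
    by rewrite path_zero; split; [exact: open_interior|].
  move=> q g _; rewrite line_cst !path_zero => /viaV gW.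
  have comp_cst (f : {path I from x0 to x0}) : f \o cst zero = cst x0.
    by apply/funext => u; rewrite /= path_zero.
  rewrite !comp_cst hol_cst invg1 mul1g mulg1.
  exact: via_sub (@interior_subset _ W) gW.
have tv : via setT x0 (p t) (hol (p \o line zero t)).
  have := via_hol (continuous_compT (line_continuous zero t) cp).
  by rewrite /= line0 line1 path_zero.
have [V Vt VW] := slt_via slt tv Wx0.
have [V' [[oV' V't] V'V pcV']] : exists V' : set X,
    [/\ open_nbhs (p t) V', V' `<=` V^° & path_connected_in R V'].
  by apply: lpc; split; [exact: open_interior|].
have [e e0 pV'] : exists2 e : R, (0 < e)%R &
    forall s, (`|ival s - ival t| < e)%R -> V' (p s).
  have : nbhs (ival t) [set x | V' (p (clamp x))].
    have pt : nbhs (clamp (ival t)) (p @^-1` V').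
      by rewrite ivalK; apply: cp; exact: open_nbhs_nbhs.
    exact: (clamp_continuous pt).
  move=> /nbhs_ballP[e /= e0 eV']; exists e => // s se.
  by rewrite -(ivalK s); apply: eV'; rewrite /ball/= distrC.
have near_e : \forall s \near t, (`|ival s - ival t| < e)%R.
  have : nbhs (ival t) [set x | (`|x - ival t| < e)%R].
    by apply/nbhs_ballP; exists e => //= x; rewrite /ball/= distrC.
  exact: (@ival_continuous R t).
have lineV' s s' : (`|ival s - ival t| < e)%R -> (`|ival s' - ival t| < e)%R ->
    range (p \o line s s') `<=` V'.
  move=> se se' _ [u _ <-] /=; apply: pV'.
  rewrite ltr_distl; apply: line_bounds; by rewrite -ltr_distl.
have via_line s s' : (`|ival s - ival t| < e)%R -> (`|ival s' - ival t| < e)%R ->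
    via V' (p s) (p s') (hol (p \o line s s')).
  move=> se se'; exists (p \o line s s'); split; rewrite /= ?line0 ?line1//.
    exact: continuous_compT (line_continuous _ _) cp.
  exact: lineV'.
have step s s' : (`|ival s - ival t| < e)%R -> (`|ival s' - ival t| < e)%R ->
    tracks s -> tracks s'.
  move=> se se' [N [C [Np Cps NW]]].
  (* D makes q s reachable from p s by a path that is short for both s and s'. *)
  have [D [[oD Dps] DC pcD]] : exists D : set X,
      [/\ open_nbhs (p s) D, D `<=` C `&` V' & path_connected_in R D].
    by apply: lpc; apply: open_nbhsI => //; split => //; exact: pV'.
  pose maps_into K O :=
    [set q : loop R x0 | (q : {path I from x0 to x0}) @` K `<=` O].
  exists (N `&` maps_into [set s] D `&` maps_into (range (line s s')) V'), V'; split.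
  - apply: filterI; [apply: filterI => //|]; apply: open_nbhs_nbhs; split.
    + by apply: open_loops_mapping => //; exact: compact_set1.
    + by move=> _ [_ -> <-].
    + apply: open_loops_mapping => //.
      apply: continuous_compact; last exact: compact_unit_interval.
      by apply: continuous_subspaceT; exact: line_continuous.
    + by move=> _ [_ [u _ <-] <-]; apply: (lineV' s s' se se'); exists u.
  - by split => //; exact: pV'.
  - move=> q g' [[Nq qsD] qV'] g'V'; have cq := @path_cts _ _ _ _ q.
    have qs : D (q s) by apply: qsD; exists s.
    have [g gD] := path_connected_in_via pcD Dps qs.
    have gV' : via V' (p s) (q s) g by apply: via_sub gD => x /DC[].
    have := NW q g Nq (via_sub (fun x Dx => (DC x Dx).1) gD).
    have qline : via V' (q s) (q s') (hol (q \o line s s')).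
      exists (q \o line s s'); split; rewrite /= ?line0 ?line1//.
        exact: continuous_compT (line_continuous _ _) cq.
      by move=> _ [u _ <-]; apply: qV'; exists (line s s' u) => //; exists u.
    set A := hol (q \o line zero s); set B := hol (p \o line zero s) => AB.
    rewrite -(hol_line_concat zero s s' cq) -(hol_line_concat zero s s' cp) -/A -/B.
    set Q := hol (q \o _); set P := hol (p \o _).
    have tB : (hol (p \o line zero t) * hol (p \o line t s))%g = B.
      exact: hol_line_concat.
    have tt : (`|ival t - ival t| < e)%R by rewrite subrr normr0.
    set T := hol (p \o line zero t) in tB VW *; set S := hol (p \o line t s) in tB.
    (* Follow p to s, cross to q, follow q to s', cross back to p, return to t. *)
    have loopV : via V (p t) (p t) (S * (g * (Q * (g'^-1 * (P^-1 * S^-1)))))%g.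
      apply: (@via_sub V'); first by apply: subset_trans V'V _; exact: interior_subset.
      have tsV := via_line t s tt se; have ssV := via_line s s' se se'.
      exact: viaM tsV (viaM gV' (viaM qline
        (viaM (viaV g'V') (viaM (viaV ssV) (viaV tsV))))).
    have := viaM AB (VW _ loopV); rewrite -tB; congr via.
    by rewrite !invgM !mulgA !mulgVK.
near=> s; have se : (`|ival s - ival t| < e)%R by near: s.
have tt : (`|ival t - ival t| < e)%R by rewrite subrr normr0.
by split; exact: step.
Unshelve. all: by end_near. Qed.

(** * The space of classes modulo H *)

Section subgroup.
Variable H : groupClosed G.
Hypothesis nH : normal_subgroup H.

Lemma lift_relP (a b : based_path R x0) :
  lift_rel H a b <-> a one = b one /\ (hol a / hol b)%g \in H.
Proof.
have ca := @bpath_cts _ _ _ a; have cb := @bpath_cts _ _ _ b.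
have crb := reverse_continuous cb.
split=> [/asboolP[ab [p pE pH]]|[ab abH]].
  split=> //; rewrite -hol_reverse// -hol_concat ?reverse0//.
  by rewrite -pE hol_loop.
apply/asboolP; split=> //.
have abr : a one = reverse b zero by rewrite reverse0.
pose p := mk_path (concat_continuous ca crb abr)
  (etrans (concat0 _ _) (bpath0 a))
  (etrans (concat1 _ _) (etrans (reverse1 _) (bpath0 b))).
exists p => //; rewrite -hol_loop.
by rewrite [hol _](hol_concat ca crb abr) hol_reverse.
Qed.

Definition rep (q : lift_space H) : based_path R x0 := repr q.

Lemma repK q : lift_class H (rep q) = q. Proof. exact: reprK. Qed.

Lemma rep_eqP (q r : lift_space H) :
  q = r <-> endpoint q = endpoint r /\ (hol (rep q) / hol (rep r))%g \in H.
Proof. by rewrite -lift_relP -(lift_classP H) !repK. Qed.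

Lemma rep_class (a : based_path R x0) : (hol (rep (lift_class H a)) / hol a)%g \in H.
Proof.
suff /lift_relP[] : lift_rel H (rep (lift_class H a)) a by [].
by apply/lift_classP; rewrite repK.
Qed.

(** Since q is only known modulo H, the whisker from a to q is determined up to
H on the left. *)
Lemma whisker_basicP (a : based_path R x0) (U : set X) (q : lift_space H) :
  whisker_basic H a U q <->
  exists2 g, via U (a one) (endpoint q) g & (hol (rep q) / (hol a * g))%g \in H.
Proof.
have ca := @bpath_cts _ _ _ a.
split=> [[y [b [bU ->]]]|[g [f [cf fU f0 f1 <-]] gH]].
  have cb := @path_cts _ _ _ _ b.
  exists (hol b).
    by exists b; split => //; rewrite ?path_zero// endpointE /= concat1.
  rewrite -hol_concat ?path_zero//.
  exact: rep_class.
exists (endpoint q), (mk_path cf f0 f1); split => //.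
rewrite -[LHS]repK; apply/lift_classP/lift_relP; split.
  by rewrite /= concat1.
by rewrite [hol (based_concat _)](hol_concat ca cf (esym f0)).
Qed.

Lemma nbhs_whisker_basic (q : whisker H) (U : set X) : open_nbhs (endpoint q) U ->
  nbhs q (whisker_basic H (rep q) U).
Proof.
move=> [oU Uq]; apply: open_nbhs_nbhs; split.
  exists [set (rep q, U)]; first by move=> _ ->.
  by rewrite bigcup_set1.
by rewrite -{2}[q]repK; exact: whisker_basic_self.
Qed.

(** The whisker sets around q itself, rather than around a nearby class, already
form a basis of neighborhoods. *)
Lemma nbhs_whiskerP (q : whisker H) (N : set (whisker H)) : nbhs q N ->
  exists2 U, open_nbhs (endpoint q) U & whisker_basic H (rep q) U `<=` N.
Proof.
rewrite nbhsE => -[B [[D Dsub <-] [[a U] Di qU]] BN].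
have [oU _] := Dsub _ Di; exists U.
  by split=> //; exact: whisker_basic_end qU.
apply: subset_trans BN => r qr; exists (a, U) => //.
by apply: whisker_basic_sub qr => //; rewrite repK.
Qed.

(** The product of the image of pi_1(W, x0) and H. As W varies, these sets are a
neighborhood basis of the class of the constant path in the fibre over x0 of the
whisker topology. *)
Definition mod_small (W : set X) (g : G) : Prop :=
  exists2 u, via W x0 x0 u & (u^-1 * g)%g \in H.

Lemma mem_conj (g h : G) : h \in H -> (g * h * g^-1)%g \in H.
Proof. by move=> /(nH (g^-1)%g); rewrite conjgE invgK mulgA. Qed.

Lemma mod_smallV W g : mod_small W g -> mod_small W g^-1%g.
Proof.
move=> [u uW ugH]; exists u^-1%g; first exact: viaV.
rewrite invgK; have /gpredVr/(mem_conj u) := ugH.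
by rewrite invgM invgK !mulgA mulgK.
Qed.

Lemma mod_smallM W g h : mod_small W g -> mod_small W h -> mod_small W (g * h)%g.
Proof.
move=> [u uW ugH] [v vW vhH]; exists (u * v)%g; first exact: viaM uW vW.
rewrite (_ : _ * _ = (v^-1 * (u^-1 * g) * v^-1^-1) * (v^-1 * h))%g.
  by apply: gpredM => //; exact: mem_conj.
by rewrite invgM !invgK !mulgA mulgK.
Qed.

Lemma mod_small_via W u : via W x0 x0 u -> mod_small W u.
Proof. by move=> uW; exists u => //; rewrite mulVg; exact: gpred1. Qed.

Lemma mod_small_mem W h : W x0 -> h \in H -> mod_small W h.
Proof. by move=> Wx hH; exists 1%g; [exact: via1|rewrite invg1 mul1g]. Qed.

Lemma mod_smallMl W g h : mod_small W g -> mod_small W (g * h)%g <-> mod_small W h.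
Proof.
move=> gW; split=> [ghW|]; last exact: mod_smallM.
by rewrite -(mulKg g h); apply: mod_smallM ghW; exact: mod_smallV.
Qed.

Lemma mod_smallMr W g h : mod_small W h -> mod_small W (g * h)%g <-> mod_small W g.
Proof.
move=> hW; split=> [ghW|gW]; last exact: mod_smallM.
by rewrite -(mulgK h g); apply: mod_smallM ghW _; exact: mod_smallV.
Qed.

(** * Unique lifting and closedness *)

(** Near t, the lifts f and g reach f s and g s from f t and g t by whiskers b and
b' in a small set, so up to H the new quotient is the old one multiplied by the
loop b b'^-1 at the end of f t, conjugated back to x0. *)
Lemma lifts_mod_small (f g : I -> whisker H) (W : set X) : slt_at R x0 ->
  continuous f -> continuous g -> f zero = g zero ->
  (forall t, endpoint (f t) = endpoint (g t)) -> nbhs x0 W ->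
  forall t, mod_small W (hol (rep (f t)) / hol (rep (g t)))%g.
Proof.
move=> slt cf cg fg0 fgE Wx0; have Wx : W x0 := nbhs_singleton Wx0.
apply: locally_constant_interval => [t|]; last first.
  by rewrite fg0 mulgV; apply: mod_small_mem => //; exact: gpred1.
set a := hol (rep (f t)); set d := hol (rep (g t)).
have av : via setT x0 (endpoint (f t)) a.
  rewrite -[X in via _ X](bpath0 (rep (f t))).
  by apply: via_hol; exact: bpath_cts.
have [V Vy VW] := slt_via slt av Wx0.
have oV : open_nbhs (endpoint (f t)) V^° by split; [exact: open_interior|].
have oV' : open_nbhs (endpoint (g t)) V^° by rewrite -fgE.
have Nf : \forall s \near t, whisker_basic H (rep (f t)) V^° (f s).
  exact: cf _ _ (nbhs_whisker_basic oV).
have Ng : \forall s \near t, whisker_basic H (rep (g t)) V^° (g s).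
  exact: cg _ _ (nbhs_whisker_basic oV').
near=> s.
have /whisker_basicP[b bV h1H] : whisker_basic H (rep (f t)) V^° (f s) by near: s.
have /whisker_basicP[b' b'V h2H] : whisker_basic H (rep (g t)) V^° (g s) by near: s.
set as_ := hol (rep (f s)) in h1H *; set ds := hol (rep (g s)) in h2H *.
have uW : via W x0 x0 (a * (b * b'^-1) * a^-1)%g.
  apply: VW; apply: via_sub (@interior_subset _ V) _.
  apply: viaM bV _; rewrite fgE; apply: viaV.
  by rewrite [X in via _ X]fgE.
rewrite (_ : as_ / ds = (as_ / (a * b)) *
  ((a * (b * b'^-1) * a^-1) * ((a / d) * (ds / (d * b'))^-1)))%g.
  have m1 := mod_small_mem Wx h1H.
  have m2 := mod_small_via uW.
  have m3 := mod_smallV (mod_small_mem Wx h2H).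
  apply: iff_trans; first exact: mod_smallMl m1.
  apply: iff_trans; first exact: mod_smallMl m2.
  exact: mod_smallMr m3.
by rewrite !invgM !invgK !mulgA !mulgVK.
Unshelve. all: by end_near. Qed.


(** Let p represent a. Loops concat q p, with q in W, converge to concat (cst x0) p
as W shrinks to x0. If a is outside H then so is the class of concat q p for
all q in some W, hence a is not the class of a loop in W times an element of H. *)
Lemma mem_of_mod_small (a : G) :
  closed ([set a | a \in H] : set (pi1_qtop R x0)) ->
  (forall W, nbhs x0 W -> mod_small W a) -> a \in H.
Proof.
move=> cH aW; apply: contrapT => naH.
pose p := pi1_repr a; have cp := @path_cts _ _ _ _ p.
have pa : pi1_class p = a by exact: pi1_reprK.
have : open (~` [set a : pi1_qtop R x0 | a \in H]) by exact: closed_openC.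
move=> [B oB BE].
have BP (q : {path I from x0 to x0}) : B q <-> ~ pi1_class q \in H.
  by move: BE; rewrite predeqE => BE; exact: (BE q).
pose F := filter_from (nbhs x0) (fun W : set X =>
  [set f : I -> X | exists2 q : {path I from x0 to x0},
     range q `<=` W & concat q p = f]).
have FF : Filter F.
  apply: filter_from_filter; first by exists setT; exact: filterT.
  move=> V W Vx Wx; exists (V `&` W); first exact: filterI.
  by move=> f [q qVW <-]; split; exists q => // x /qVW[].
have Fp : F --> (concat (cst x0) p : {compact-open, I -> X}).
  apply/compact_open_cvgP => K O cK oO KO.
  (* If K meets the first half then O contains x0 and constrains q; otherwise q
     is not seen at all. *)
  have [[t [Kt th]]|noK] := pselect (exists t, K t /\ (ival t <= 2^-1)%R).
    have Ox : O x0 by apply: KO; exists t => //; rewrite /concat th.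
    exists O; first exact: open_nbhs_nbhs.
    move=> _ [q qO <-] _ [s Ks <-].
    have : O (concat (cst x0) p s) by apply: KO; exists s.
    by rewrite /concat; case: ifP => // _ _; apply: qO; eexists.
  exists setT; first exact: filterT.
  move=> _ [q _ <-] _ [s Ks <-]; have : O (concat (cst x0) p s) by apply: KO; exists s.
  by rewrite /concat; case: ifP => // sh; case: noK; exists s.
have BF : F B.
  apply: Fp; apply: open_nbhs_nbhs; split=> //.
  apply/(BP (concat (cst x0) p)); rewrite -pi1_mulE pa.
  by rewrite [X in X \in _](pi1_mul1g a).
have [W Wx WB] := BF; have [u [f [cf fW f0 f1 <-]] ufH] := aW _ Wx.
pose q : {path I from x0 to x0} := mk_path cf f0 f1.
(* With a = [q] h and h in H, the loop concat (reverse q) p has class h. *)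
have /BP : B (concat (reverse q) p).
  by apply: WB; exists (reverse q) => //; exact: range_reverse_subset.
have rfp : reverse f one = p zero by rewrite reverse1 f0 path_zero.
apply; rewrite -hol_loop [hol _](hol_concat (reverse_continuous cf) cp rfp).
by rewrite hol_reverse// (hol_loop p) pa.
Qed.

(** If mod_small W misses the class of p, then H misses the classes of all loops
near p, as these lie in the same coset of mod_small W as the class of p. *)
Lemma mod_small_closed : locally_path_connected R X -> slt_at R x0 ->
  (forall a, (forall W, nbhs x0 W -> mod_small W a) -> a \in H) ->
  closed ([set a | a \in H] : set (pi1_qtop R x0)).
Proof.
move=> lpc slt Hsmall.
rewrite -[X in closed X]setCK; apply: open_closedC.
suff : open [set q : loop R x0 | ~ pi1_class q \in H] by [].
rewrite openE => p npH.
have /existsNP[W /not_implyP[Wx npW]] :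
    ~ forall W, nbhs x0 W -> mod_small W (pi1_class p).
  by move=> /Hsmall.
apply: filterS (nearby_loops p lpc slt Wx) => q qW qH; apply: npW.
rewrite -hol_loop (_ : hol p = (hol q / hol p)^-1 * hol q)%g; last first.
  by rewrite invgF mulgVK.
apply: mod_smallM; first by apply: mod_smallV; exact: mod_small_via.
by apply: mod_small_mem; [exact: nbhs_singleton|rewrite hol_loop].
Qed.

(** Over the constant path at x0, compare the constant lift with the one that jumps
to the class of a loop representing a immediately after time 0. It is continuous
at 0 because a has representatives modulo H in every neighborhood of x0. *)
Lemma upl_mem (a : G) : unique_path_lifting R (endpoint_proj (H := H)) ->
  (forall W, nbhs x0 W -> mod_small W a) -> a \in H.
Proof.
move=> upl aW.
pose c : based_path R x0 := BasedPath (@cst_continuous I X x0) erefl.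
pose p := pi1_repr a; have cp := @path_cts _ _ _ _ p.
have pa : hol p = a by rewrite hol_loop; exact: pi1_reprK.
pose b : based_path R x0 := BasedPath cp (@path_zero _ _ _ _ p).
pose jump (t : I) : whisker H := if t == zero then lift_class H c else lift_class H b.
have endc : endpoint (lift_class H c) = x0 by rewrite endpointE.
have endb : endpoint (lift_class H b) = x0 by rewrite endpointE /= path_one.
have holc : hol c = 1%g by exact: hol_cst.
have : cst (lift_class H c : whisker H) = jump.
  apply: upl => //.
  - exact: cst_continuous.
  - move=> t N; rewrite {1}/jump => Nt.
    suff : \forall s \near t, N (jump s) by [].
    move: Nt; case: eqP => [_ /nbhs_whiskerP[U]|/eqP t0].
      rewrite endc => Ux UN; near=> s; rewrite /jump; case: ifP => _; apply: UN.
        have Uc : U (endpoint (lift_class H c)) by rewrite endc; case: Ux.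
        by rewrite -{2}[lift_class H c]repK; exact: whisker_basic_self.
      have [u uU uaH] := aW U (open_nbhs_nbhs Ux).
      apply/whisker_basicP; exists u; first by rewrite endb [rep _ one]endc.
      have bH := rep_class b; have := rep_class c.
      rewrite holc divg1 => cH.
      rewrite (_ : _ / _ = (hol (rep (lift_class H b)) / a) *
        (u * (u^-1 * a) * u^-1) * (hol (rep (lift_class H c)))^-1)%g.
        apply: gpredM; last exact: gpredVr.
        apply: gpredM; last exact: mem_conj.
        by rewrite -pa.
      by rewrite invgM !mulgA mulgK mulgVK.
    move=> /nbhs_singleton Nb.
    have t_gt0 : (0 < ival t)%R.
      rewrite lt0r ival_ge0 andbT; apply: contra t0 => /eqP it.
      by apply/eqP/ival_inj; rewrite it ival0.
    have near_pos : \forall s \near t, (0 < ival s)%R.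
      have : nbhs (ival t) [set x | (0 < x)%R] by exact: lt_nbhsr.
      exact: (@ival_continuous R t).
    near=> s; have s_gt0 : (0 < ival s)%R by near: s.
    by rewrite /jump ifF//; apply: contraTF s_gt0 => /eqP ->; rewrite ival0 ltxx.
  - by rewrite /jump eqxx.
  - apply/funext => t; rewrite /jump /endpoint_proj /=.
    by case: ifP; rewrite ?endc ?endb.
move=> /(congr1 (@^~ one)); rewrite /jump /= ifF; last first.
  by apply/negbTE; rewrite eq_sym; exact: zero_one_neq.
move=> /lift_classP/lift_relP[_]; rewrite holc div1g pa => /gpredVr; by rewrite invgK.
Unshelve. all: by end_near. Qed.

End subgroup.

End holonomy.

Lemma connecting_paths (R : realType) (X : topologicalType) (x0 : X) :
  path_connected R X -> exists k : X -> unit_interval R -> X,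
  [/\ (forall x, continuous (k x)), (forall x, k x zero = x0), (forall x, k x one = x) &
      k x0 = cst x0].
Proof.
move=> pc.
have ex x : exists f : unit_interval R -> X,
    [/\ continuous f, f zero = x0, f one = x & x = x0 -> f = cst x0].
  have [->|xx0] := pselect (x = x0).
    by exists (cst x0); split => //; exact: cst_continuous.
  have [p _] := pc x0 x I I; exists p.
  by split; rewrite ?path_zero ?path_one//; exact: path_cts.
have [k kP] := choice ex.
exists k; split => [x|x|x|]; last by have [_ _ _ ->] := kP x0.
- by have [] := kP x.
- by have [] := kP x.
- by have [] := kP x.
Qed.

Theorem corollary2p8 (R : realType) (X : topologicalType) (x0 : X)
    (H : groupClosed (pi1 R x0)) :
  path_connected R X -> locally_path_connected R X -> slt_at R x0 ->
  normal_subgroup H ->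
  unique_path_lifting R (endpoint_proj (H := H)) <->
  closed ([set a | a \in H] : set (pi1_qtop R x0)).
Proof.
move=> pc lpc slt nH.
have [k [kc k0 k1 kb]] := connecting_paths x0 pc.
split=> [upl|cH f g cf cg fg0 fgE].
  by apply: (mod_small_closed kc k0 k1 kb nH lpc slt) => a; exact: upl_mem.
have endE t : endpoint (f t) = endpoint (g t) by exact: (congr1 (@^~ t) fgE).
apply/funext => t; apply/(rep_eqP kc k0 k1 kb); split=> //.
apply: (mem_of_mod_small kc k0 k1 kb) => // W Wx0.
exact: lifts_mod_small.
Qed.
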